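(* Let $P\in\operatorname{End}_{M_n(\mathbb C)}(V^n)$ be self-adjoint, let $(e_k)_{k=0}^N$ and $(\phi_j)_{j=0}^N$ be orthonormal $M_n(\mathbb C)$-bases of $V^n$ with $$P\cdot e_k=A_{k+1}^*e_{k+1}+B_ke_k+A_ke_{k-1},\qquad P\cdot\phi_j=\alpha_j\phi_j,\qquad k,j=0,\dots,N,$$ where $A_k,B_k,\alpha_j\in M_n(\mathbb C)$, $B_k=B_k^*$, $e_{-1}=e_{N+1}=0$. Assume that the matrices $(e_0,\phi_j)\in M_n(\mathbb C)$ are invertible for $j=0,\dots,N$, and put $\theta_j=(e_0,\phi_j)\,\alpha_j^*\,(e_0,\phi_j)^{-1}$. If $(\theta_j)_{j=0}^N$ satisfies the Vandermonde condition and $A_k$ is invertible for all $k=1,\dots,N$, then there exists a unique family of matrix valued polynomials $$\Pi_k(x)=M_{k,k}x^k+M_{k,k-1}x^{k-1}+\dots+M_{k,0},\qquad x\in M_n(\mathbb C),\quad k=0,\dots,N,$$ with coefficients $M_{k,i}\in M_n(\mathbb C)$ and invertible leading coefficient $M_{k,k}$, satisfying for all $j,k=0,\dots,N$ $$A_{k+1}^*\Pi_{k+1}(\theta_j)+B_k\Pi_k(\theta_j)+A_k\Pi_{k-1}(\theta_j)=\Pi_k(\theta_j)\theta_j,\qquad \Pi_{-1}(\theta_j)=0,\quad \Pi_0(\theta_j)=I_n,$$ (where for $k=N$ the term containing $\Pi_{N+1}$ is omitted). Moreover, these polynomials satisfy the orthogonality relation $$\sum_{j=0}^{N}\Pi_k(\theta_j)\,W(j)\,\Pi_l(\theta_j)^*=\delta_{k,l}I_n,\qquad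 k,l=0,\dots,N,$$ where $W(j)=(e_0,\phi_j)(e_0,\phi_j)^*$.
   Context: $A^*$ is the conjugate transpose of a square complex matrix $A$. $V$ is a complex vector space of dimension $n(N+1)$ with a positive definite Hermitian inner product $\langle\cdot,\cdot\rangle$, linear in the first argument. $V^n$ is the left $M_n(\mathbb C)$-module with action $A(v_1,\dots,v_n)=(\sum_k a_{1k}v_k,\dots,\sum_k a_{nk}v_k)$, and it carries the matrix valued inner product $(v,w)=(\langle v_i,w_j\rangle)_{i,j}\in M_n(\mathbb C)$. It satisfies $(Av,w)=A(v,w)$ and $(v,Aw)=(v,w)A^*$. $V^n$ is a free $M_n(\mathbb C)$-module of rank $N+1$; an $M_n(\mathbb C)$-basis is a basis of it as a free module. A basis $(e_k)$ is orthonormal if $(e_k,e_l)=\delta_{k,l}I_n$. An operator $T\in\operatorname{End}_{M_n(\mathbb C)}(V^n)$ is self-adjoint if $(Tv,w)=(v,Tw)$ for all $v,w\in V^n$. Vandermonde condition: a family $(\theta_j)_{j=0}^N$ in $M_n(\mathbb C)$ (whose entries are rational functions of $j$ without poles at $0,\dots,N$) satisfies the Vandermonde condition if for every $k\in\{1,\dots,N\}$ the block matrix $V(\theta_0,\dots,\theta_k)$ whose $(r,s)$ block is $\theta_s^r$ ($r,s=0,\dots,k$, with $\theta_s^0=I_n$) is invertible. Matrix polynomials are evaluated at a matrix $x$ with coefficients on the left, $\Pi(x)=\sum_i M_i x^i$. *)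

(* Defs.v *)
From HB Require Import structures.
From mathcomp Require Import all_boot all_order all_algebra.
From mathcomp Require Import reals.
From mathcomp Require Export complex.

Set Implicit Arguments.
Unset Strict Implicit.
Unset Printing Implicit Defensive.

Import GRing.Theory Num.Theory.

Local Open Scope ring_scope.
Local Open Scope sesquilinear_scope.

Section MatrixModule.
Variables (K : nzRingType) (V : lmodType K) (n : nat).

(* V^n. This is an alias of {ffun 'I_n -> V} because the latter already carries
   its pointwise K-module structure, whereas here the scalars are 'M[K]_n. *)
Definition mpow : Type := {ffun 'I_n -> V}.

HB.instance Definition _ := GRing.Zmodule.on mpow.

Definition mact (A : 'M[K]_n) (v : mpow) : mpow :=
  [ffun i => \sum_k A i k *: v k].

Fact mactA (A B : 'M[K]_n) (v : mpow) : mact A (mact B v) = mact (A *m B) v.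
Proof.
apply/ffunP=> i; rewrite !ffunE.
under eq_bigr => k _ do rewrite ffunE scaler_sumr.
rewrite exchange_big /=; apply: eq_bigr => j _.
by rewrite mxE scaler_suml; apply: eq_bigr => k _; rewrite scalerA.
Qed.

Fact mact1 (v : mpow) : mact 1%:M v = v.
Proof.
apply/ffunP=> i; rewrite ffunE (bigD1 i) //= mxE eqxx scale1r big1 ?addr0 //.
by move=> k ki; rewrite mxE eq_sym (negPf ki) scale0r.
Qed.

Fact mactDr (A : 'M[K]_n) (v w : mpow) : mact A (v + w) = mact A v + mact A w.
Proof.
apply/ffunP=> i; rewrite !ffunE -big_split /=.
by apply: eq_bigr => k _; rewrite ffunE scalerDr.
Qed.

Fact mactDl (v : mpow) (A B : 'M[K]_n) : mact (A + B) v = mact A v + mact B v.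
Proof.
apply/ffunP=> i; rewrite !ffunE -big_split /=.
by apply: eq_bigr => k _; rewrite mxE scalerDl.
Qed.

(* Hence {linear mpow V n -> mpow V n} is the type of 'M[K]_n-module
   endomorphisms of V^n. *)
HB.instance Definition _ := GRing.Zmodule_isLmodule.Build 'M[K]_n mpow
  mactA mact1 (fun A v w => mactDr A v w) mactDl.

End MatrixModule.

Definition is_module_basis (S : nzRingType) (M : lmodType S) (N : nat)
    (b : 'I_N -> M) : Prop :=
  (forall v : M, exists c : 'I_N -> S, v = \sum_k c k *: b k) /\
  (forall c : 'I_N -> S, \sum_k c k *: b k = 0 -> forall k, c k = 0).

Section MatrixInnerProduct.
Variables (C : numClosedFieldType) (V : lmodType C) (n : nat).
Variable ip : {dot V for Num.conj}.

Definition mxip (v w : mpow V n) : 'M[C]_n := \matrix_(i, j) ip (v i) (w j).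

Definition selfadjoint (T : mpow V n -> mpow V n) : Prop :=
  forall v w, mxip (T v) w = mxip v (T w).

Definition orthonormal_family (N : nat) (b : 'I_N -> mpow V n) : Prop :=
  forall k l, mxip (b k) (b l) = (k == l)%:R%:M.

End MatrixInnerProduct.

(* A family indexed by 0..N, extended by zero to all integer indices, so that
   members of index -1 and N+1 are 0. *)
Definition ext0 (M : nmodType) (N : nat) (f : 'I_N.+1 -> M) (k : int) : M :=
  if k is Posz m then oapp f 0 (insub m) else 0.

Section Vandermonde.
Variables (C : numFieldType) (n N : nat).
Implicit Type theta : 'I_N.+1 -> 'M[C]_n.+1.

Definition rational_entries theta : Prop :=
  forall a b, exists p q : {poly C}, forall j : 'I_N.+1,
    q.[j%:R] != 0 /\ theta j a b = p.[j%:R] / q.[j%:R].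

Definition vandermonde_mx theta (k : 'I_N.+1) :=
  \mxblock_(r < k.+1, s < k.+1) (theta (widen_ord (ltn_ord k) s) ^+ r).

Definition vandermonde_condition theta : Prop :=
  rational_entries theta /\
  forall k : 'I_N.+1, (1 <= k)%N -> vandermonde_mx theta k \in unitmx.

End Vandermonde.

Section Recurrence.
Variables (C : numClosedFieldType) (n N : nat).
Variables (A : nat -> 'M[C]_n.+1) (B theta : 'I_N.+1 -> 'M[C]_n.+1).

(* Horner evaluation in {poly 'M[C]_n.+1} keeps the coefficients on the left of
   the powers of the point. With ext0, the term in Pi_(N+1) is 0 for k = N. *)
Definition recurrence_family
    (Pi : {ffun 'I_N.+1 -> {poly 'M[C]_n.+1}}) : Prop :=
  [/\ forall k : 'I_N.+1,
        (size (Pi k) <= k.+1)%N /\ (Pi k)`_k \is a GRing.unit,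
      forall j, (Pi ord0).[theta j] = 1
    & forall j k : 'I_N.+1,
        (A k.+1)^t* * (ext0 Pi (k%:Z + 1)).[theta j]
          + B k * (Pi k).[theta j]
          + A k * (ext0 Pi (k%:Z - 1)).[theta j]
        = (Pi k).[theta j] * theta j].

End Recurrence.

(* Main.v *)
(* Let Q_k(j) = (e_k, phi_j).  Self-adjointness of P turns its block tridiagonal
   form on (e_k) into a three-term recurrence for Q_k(j) with alpha_j^* acting on
   the right, so F_k(j) = Q_k(j) Q_0(j)^-1 satisfies the same recurrence with
   theta_j on the right, and F_0 = 1.  As the A_k are invertible, such a
   recurrence determines its solution from the initial value; hence polynomials
   Pi_k built by the recurrence for k < N satisfy Pi_k(theta_j) = F_k(j), and the
   equation for k = N comes for free from the one for F.  The coefficients of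
   Pi_k are determined by the values F_k(j) through the block Vandermonde matrix,
   and orthogonality is Parseval's identity for (e_k, e_l) in the basis (phi_j). *)
Require Import Defs.
From HB Require Import structures.
From mathcomp Require Import all_boot all_order all_algebra.
From mathcomp Require Import reals.

Set Implicit Arguments.
Unset Strict Implicit.
Unset Printing Implicit Defensive.

Import GRing.Theory Num.Theory.

Local Open Scope ring_scope.
Local Open Scope sesquilinear_scope.

Lemma ext0_comp (M M' : nmodType) N (g : M -> M') (f : 'I_N.+1 -> M) k :
  g 0 = 0 -> g (ext0 f k) = ext0 (fun i => g (f i)) k.
Proof. by case: k => [m|m] //= g0; case: insub. Qed.

Lemma eq_ext0 (M : nmodType) N (f g : 'I_N.+1 -> M) k :
  f =1 g -> ext0 f k = ext0 g k.
Proof. by case: k => [m|m] //= fg; case: insub => //= i; rewrite fg. Qed.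

Lemma ext0_ord (M : nmodType) N (f : 'I_N.+1 -> M) (k : 'I_N.+1) :
  ext0 f k = f k.
Proof. by rewrite /= valK. Qed.

Lemma ext0_next (M : nmodType) N (f : 'I_N.+1 -> M) k :
  (k < N)%N -> ext0 f (k%:Z + 1) = f (inord k.+1).
Proof.
move=> kN; rewrite -[RHS]ext0_ord; congr (ext0 f _).
by rewrite inordK // -PoszD addn1.
Qed.

Lemma ext0_prev (M : nmodType) N (f : 'I_N.+1 -> M) k : (k <= N.+1)%N ->
  ext0 f (k%:Z - 1) = if k is m.+1 then f (inord m) else 0.
Proof.
case: k => [//|m] mN; rewrite -[RHS]ext0_ord; congr (ext0 f _).
by rewrite inordK // -addn1 PoszD addrK.
Qed.

Section Recurrence.
Variables (S : unitRingType) (N : nat) (a b c : nat -> S).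

(** The equation of index N is left out: it produces no new term and only constrains [t], whereas
    the others can be solved one after another for any [t]. *)
Definition recurrence_upto (t : S) (f : 'I_N.+1 -> S) : Prop :=
  forall k : 'I_N.+1, (k < N)%N ->
    a k.+1 * ext0 f (k%:Z + 1) + b k * f k + c k * ext0 f (k%:Z - 1) = f k * t.

Hypothesis a_unit : forall k, (1 <= k <= N)%N -> a k \is a GRing.unit.

(** Since [a k.+1] is invertible, the equation of index k determines the term k+1 from the two terms
    before it. *)
Lemma recurrence_upto_inj (t : S) (f g : 'I_N.+1 -> S) :
  recurrence_upto t f -> recurrence_upto t g -> f ord0 = g ord0 -> f =1 g.
Proof.
move=> rf rg fg0 i; rewrite -(inord_val i); move: (nat_of_ord i) (ltn_ord i).
elim/ltn_ind => [[|k]] IH kN; first by rewrite (inord_val (ord0 : 'I_N.+1)).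
have kv : (inord k : 'I_N.+1) = k :> nat by rewrite inordK // ltnW.
have := rf (inord k); have := rg (inord k); rewrite kv => /(_ kN) + /(_ kN).
rewrite !ext0_next // !ext0_prev; try exact: (ltnW (ltnW kN)).
rewrite (IH k (ltnSn k) (ltnW kN)) => <-.
move=> /eqP; rewrite -subr_eq0.
have -> : (if k is m.+1 then f (inord m) else 0)
        = (if k is m.+1 then g (inord m) else 0).
  by case: k kN IH {kv} => // m mN IH; rewrite IH // ltnW // ltnW.
rewrite opprD addrACA subrr addr0 opprD addrACA subrr addr0 subr_eq0 => /eqP.
exact: mulrI (@a_unit k.+1 kN) _ _.
Qed.

(** The recurrence solved for its top term, with right multiplication by [t] replaced by right
    multiplication by ['X]. *)
Fixpoint recurrence_poly (k : nat) : {poly S} :=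
  if k is k1.+1 then
    (a k)^-1%:P * (recurrence_poly k1 * 'X - (b k1)%:P * recurrence_poly k1
      - (c k1)%:P * (if k1 is k2.+1 then recurrence_poly k2 else 0))
  else 1.

Lemma coef_recurrence_poly k i : (k < i)%N -> (recurrence_poly k)`_i = 0.
Proof.
elim/ltn_ind: k i => [[|k]] IH [//|i] ki; first by rewrite /= coef1.
rewrite ltnS in ki; rewrite /= coefCM !coefB coefMX !coefCM /=.
rewrite (IH k (ltnSn k) i ki) (IH k (ltnSn k) i.+1 (leqW ki)) mulr0 !sub0r oppr0 sub0r.
case: k ki IH => [|m] ki IH; first by rewrite coef0 mulr0 oppr0 mulr0.
by rewrite IH ?mulr0 ?oppr0 ?mulr0 // ltnW // ltnW.
Qed.

(** Only the term in ['X] reaches the top degree, so each step multiplies the leading coefficient on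
    the left by [(a k)^-1]. *)
Lemma lead_coef_recurrence_poly k :
  (k <= N)%N -> (recurrence_poly k)`_k \is a GRing.unit.
Proof.
elim: k => [|k IH] kN; first by rewrite /= coef1 unitr1.
rewrite /= coefCM !coefB coefMX !coefCM /=.
rewrite (coef_recurrence_poly (ltnSn k)) mulr0 subr0.
rewrite [X in c k * X](_ : _ = 0); last first.
  by case: k {IH kN} => [|m]; rewrite ?coef0 ?coef_recurrence_poly.
by rewrite mulr0 subr0 unitrMl ?unitrV ?a_unit // IH // ltnW.
Qed.

(** Over a noncommutative ring evaluation is not multiplicative, but it respects multiplication by a
    constant on the left and by ['X] on the right, and [recurrence_poly] is built from such products
    only. *)
Lemma horner_recurrence_poly (t : S) :
  recurrence_upto t (fun k => (recurrence_poly k).[t]).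
Proof.
move=> k kN; rewrite ext0_next // ext0_prev 1?ltnW //.
rewrite inordK // [recurrence_poly k.+1]/= hornerCM mulVKr ?a_unit //.
rewrite !hornerD !hornerN !hornerCM hornerMX.
case: k kN => [[|m] mN] /= kN.
  by rewrite horner0 mulr0 !subr0 addr0 subrK.
by rewrite inordK 1?ltnW // addrAC !subrK.
Qed.

End Recurrence.

(** As coefficients stand to the left of the powers, the block row of coefficients of [p] times the
    Vandermonde matrix is the block row of the values of [p] at the first k+1 points. *)
Lemma vandermonde_poly_eq0 (C : numFieldType) n N
    (theta : 'I_N.+1 -> 'M[C]_n.+1) (k : 'I_N.+1) (p : {poly 'M[C]_n.+1}) :
  vandermonde_mx theta k \in unitmx -> (size p <= k.+1)%N ->
  (forall j, p.[theta j] = 0) -> p = 0.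
Proof.
move=> Vunit sp p0.
have : (\mxrow_(i < k.+1) p`_i) *m vandermonde_mx theta k = 0.
  rewrite mul_mxrow_mxblock -[RHS]mxrow0.
  apply: eq_mxrow => s; rewrite -[RHS](p0 (widen_ord (ltn_ord k) s)).
  by rewrite (horner_coef_wide _ sp).
move/(congr1 (mulmx^~ (invmx (vandermonde_mx theta k)))).
rewrite mulmxK // mul0mx -mxrow0 => /eq_mxrowP coef0'.
apply/polyP => i; rewrite coef0; case: (ltnP i k.+1) => [ik|ki].
  exact: (coef0' (Ordinal ik)).
by rewrite nth_default // (leq_trans sp).
Qed.

Lemma vandermonde_poly_inj (C : numFieldType) n N
    (theta : 'I_N.+1 -> 'M[C]_n.+1) (k : 'I_N.+1) (p q : {poly 'M[C]_n.+1}) :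
  (forall k : 'I_N.+1, (1 <= k)%N -> vandermonde_mx theta k \in unitmx) ->
  (size p <= k.+1)%N -> (size q <= k.+1)%N ->
  (forall j, p.[theta j] = q.[theta j]) -> p = q.
Proof.
move=> vdm sp sq pq; apply/eqP; rewrite -subr_eq0; apply/eqP.
have spq : (size (p - q)%R <= k.+1)%N.
  by rewrite (leq_trans (size_polyD _ _)) // size_polyN geq_max sp.
have pq0 j : (p - q).[theta j] = 0 by rewrite hornerD hornerN pq subrr.
(* The Vandermonde condition starts at k = 1. For k = 0 the difference is a constant, and its value
   at one point decides. *)
have [k0|k0] := posnP k; last exact: (vandermonde_poly_eq0 (vdm k k0) spq pq0).
rewrite k0 in spq; move: (pq0 ord0); rewrite (size1_polyC spq) hornerC => ->.
by rewrite polyC0.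
Qed.

Lemma trmxC_mul (C : numClosedFieldType) m n p
    (A : 'M[C]_(m, n)) (B : 'M[C]_(n, p)) : (A *m B)^t* = B^t* *m A^t*.
Proof. by rewrite trmx_mul map_mxM. Qed.

Section MatrixInnerProduct.
Variables (C : numClosedFieldType) (V : lmodType C) (n : nat).
Variable ip : {dot V for Num.conj}.
Implicit Types v w : mpow V n.

Lemma mxip_sym v w : mxip ip w v = (mxip ip v w)^t*.
Proof. by apply/matrixP => i j; rewrite !mxE hermC expr0 mul1r. Qed.

Lemma mxipDl v1 v2 w : mxip ip (v1 + v2) w = mxip ip v1 w + mxip ip v2 w.
Proof. by apply/matrixP => i j; rewrite !mxE ffunE linearDl. Qed.

Lemma mxip0l w : mxip ip 0 w = 0.
Proof. by apply/matrixP => i j; rewrite !mxE ffunE linear0l. Qed.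

Lemma mxipZl (A : 'M[C]_n) v w : mxip ip (A *: v) w = A *m mxip ip v w.
Proof.
apply/matrixP => i j; rewrite !mxE ffunE linear_sumlz.
by apply: eq_bigr => k _; rewrite linearZl_LR mxE.
Qed.

Lemma mxipZr (A : 'M[C]_n) v w : mxip ip v (A *: w) = mxip ip v w *m A^t*.
Proof. by rewrite mxip_sym mxipZl trmxC_mul -mxip_sym. Qed.

Lemma mxip_suml (I : finType) (f : I -> mpow V n) w :
  mxip ip (\sum_i f i) w = \sum_i mxip ip (f i) w.
Proof.
by elim/big_rec2: _ => [|i x y _ <-]; rewrite ?mxip0l ?mxipDl.
Qed.

End MatrixInnerProduct.

(** Expand [v] in [b]: by orthonormality its coefficients are the products (v, b_j), and each (b_j,
    w) is the adjoint of (w, b_j). *)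
Lemma mxip_parseval (C : numClosedFieldType) (V : lmodType C) n
    (ip : {dot V for Num.conj}) N (b : 'I_N -> mpow V n.+1) v w :
  is_module_basis b -> orthonormal_family ip b ->
  mxip ip v w = \sum_j mxip ip v (b j) *m (mxip ip w (b j))^t*.
Proof.
move=> [span _] orth; have [c ->] := span v.
have coord j : mxip ip (\sum_k c k *: b k) (b j) = c j.
  rewrite mxip_suml (bigD1 j) //= big1 => [|k kj].
    by rewrite mxipZl orth eqxx mulmx1 addr0.
  by rewrite mxipZl orth (negPf kj) raddf0 mulmx0.
rewrite mxip_suml; apply: eq_bigr => j _.
by rewrite coord mxipZl -mxip_sym.
Qed.

Theorem proposition3p4 (R : realType) (n N : nat) (V : vectType R[i])
  (dimV : \dim {:V} = (n.+1 * N.+1)%N)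
  (ip : {dot V for Num.conj})
  (P : {linear mpow V n.+1 -> mpow V n.+1})
  (P_sa : selfadjoint ip P)
  (e phi : 'I_N.+1 -> mpow V n.+1)
  (e_basis : is_module_basis e) (e_orth : orthonormal_family ip e)
  (phi_basis : is_module_basis phi) (phi_orth : orthonormal_family ip phi)
  (A : nat -> 'M[R[i]]_n.+1) (B alpha : 'I_N.+1 -> 'M[R[i]]_n.+1)
  (B_herm : forall k, B k = (B k)^t*)
  (P_e : forall k : 'I_N.+1,
     P (e k) = (A k.+1)^t* *: ext0 e (k%:Z + 1) + B k *: e k
               + A k *: ext0 e (k%:Z - 1))
  (P_phi : forall j, P (phi j) = alpha j *: phi j)
  (e0_phi_unit : forall j, mxip ip (e ord0) (phi j) \is a GRing.unit)
  (theta : 'I_N.+1 -> 'M[R[i]]_n.+1)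
  (theta_def : forall j, theta j =
     mxip ip (e ord0) (phi j) * (alpha j)^t* * (mxip ip (e ord0) (phi j))^-1)
  (theta_vdm : vandermonde_condition theta)
  (A_unit : forall k : nat, (1 <= k <= N)%N -> A k \is a GRing.unit) :
  (exists! Pi, recurrence_family A B theta Pi) /\
  (forall Pi, recurrence_family A B theta Pi ->
     let W j := mxip ip (e ord0) (phi j) * (mxip ip (e ord0) (phi j))^t* in
     forall k l : 'I_N.+1,
       \sum_j (Pi k).[theta j] * W j * ((Pi l).[theta j])^t* = (k == l)%:R).
Proof.
pose Q k j := mxip ip (e k) (phi j).
have Q_rec j (k : 'I_N.+1) :
    (A k.+1)^t* * ext0 (Q^~ j) (k%:Z + 1) + B k * Q k j
      + A k * ext0 (Q^~ j) (k%:Z - 1) = Q k j * (alpha j)^t*.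
  have := P_sa (e k) (phi j); rewrite P_phi mxipZr P_e !mxipDl !mxipZl.
  by rewrite !(ext0_comp (g := fun v => mxip ip v (phi j))) ?mxip0l.
pose F k j := Q k j * (Q ord0 j)^-1.
have F_rec j (k : 'I_N.+1) :
    (A k.+1)^t* * ext0 (F^~ j) (k%:Z + 1) + B k * F k j
      + A k * ext0 (F^~ j) (k%:Z - 1) = F k j * theta j.
  have extF m : ext0 (F^~ j) m = ext0 (Q^~ j) m * (Q ord0 j)^-1.
    by rewrite (ext0_comp (g := fun x => x * (Q ord0 j)^-1)) ?mul0r.
  (* The inverse of Q_0(j) in F_k(j) cancels the first factor of theta_j, so this is the equation
     for Q multiplied on the right by the inverse of Q_0(j). *)
  rewrite !extF theta_def /F !mulrA divrK ?e0_phi_unit // -!mulrDl.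
  by rewrite Q_rec.
(* Beyond N, [inord] gives [b] a default value; the recurrence is only used at indices below N. *)
pose a k := (A k)^t*; pose b k := B (inord k).
have a_unit k : (1 <= k <= N)%N -> a k \is a GRing.unit.
  move=> /A_unit Ak; change ((A k)^t* \in unitmx).
  by rewrite map_unitmx unitmx_tr.
have F_upto j : recurrence_upto a b A (theta j) (F^~ j).
  by move=> k _; rewrite /b inord_val F_rec.
have F0 j : F ord0 j = 1 by rewrite /F divrr ?e0_phi_unit.
have horner_ext0 (Pi : {ffun 'I_N.+1 -> {poly 'M[R[i]]_n.+1}}) m x :
    (ext0 Pi m).[x] = ext0 (fun k => (Pi k).[x]) m.
  by rewrite (ext0_comp (g := fun p : {poly _} => p.[x])) ?horner0.
(* The equations with k < N and the initial value 1 already fix the values of any solution at the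
   points theta_j; both uniqueness and orthogonality rest on this. *)
have Pi_F Pi : recurrence_family A B theta Pi ->
    forall k j, (Pi k).[theta j] = F k j.
  move=> [_ Pi0 Pi_rec] k j; move: k.
  apply: (recurrence_upto_inj a_unit _ (F_upto j)); last by rewrite Pi0 F0.
  by move=> k _; rewrite /b inord_val -Pi_rec !horner_ext0.
have [_ vdm] := theta_vdm.
split.
  pose p : {ffun 'I_N.+1 -> {poly 'M[R[i]]_n.+1}} :=
    [ffun k : 'I_N.+1 => recurrence_poly a b A k].
  have p_F k j : (p k).[theta j] = F k j.
    rewrite ffunE; move: k.
    apply: (recurrence_upto_inj a_unit _ (F_upto j)).
      exact: horner_recurrence_poly.
    by rewrite hornerC F0.
  have p_rec : recurrence_family A B theta p.
    split=> [k|j|j k].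
    - rewrite ffunE; split; last first.
        exact: (lead_coef_recurrence_poly _ _ a_unit (ltn_ord k)).
      by apply/leq_sizeP => i ki; rewrite coef_recurrence_poly.
    - by rewrite p_F F0.
    - by rewrite !horner_ext0 !(eq_ext0 _ (p_F^~ j)) p_F F_rec.
  exists p; split=> // q q_rec; apply/ffunP => k.
  have [[sp _ _] [sq _ _]] := (p_rec, q_rec).
  apply: (vandermonde_poly_inj vdm (sp k).1 (sq k).1) => j.
  by rewrite p_F (Pi_F _ q_rec).
move=> Pi /Pi_F Pi_E W k l.
have <- : mxip ip (e k) (e l) = (k == l)%:R.
  by rewrite e_orth; case: eqP => _ //; rewrite raddf0.
rewrite (mxip_parseval _ _ phi_basis phi_orth).
apply: eq_bigr => j _; rewrite !Pi_E -[mxip ip (e k) _]/(Q k j).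
(* The two factors of [W j] turn F_k(j) and the adjoint of F_l(j) into Q_k(j) and the adjoint of
   Q_l(j), which is Parseval's summand. *)
have FQ m : F m j * Q ord0 j = Q m j by rewrite divrK ?e0_phi_unit.
by rewrite -(FQ k) -[mxip ip (e l) _](FQ l) [in RHS]trmxC_mul -!mulmxE !mulmxA.
Qed.
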